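(* Let $M\in\mathrm{Mod}_\Sigma^\varphi$ and let $\varphi:M\to M$ be $\varphi(x)=c^{-r}\varphi_r(E(u)^rx)$. For $n\ge1$ let $(\varphi^* )^nM$ be the $\Sigma$-submodule of $M$ generated by $\varphi^n(M)$. Then $M^{\mathrm m}:=\bigcap_{n=1}^\infty(\varphi^* )^nM$ is a finite free $\Sigma$-module.
   Context: $p$ prime, $0\le r\le p-1$, $k$ perfect of characteristic $p$, $E(u)\in W(k)[u]$ the Eisenstein polynomial (degree $e$) of a uniformizer of a totally ramified extension $K$ of $W(k)[1/p]$. $S$ is the $p$-adic completion of the divided power envelope of $W(k)[u]$ w.r.t. $(E(u))$, with $\mathrm{Fil}^jS$ the $p$-adic completion of the ideal generated by $E(u)^i/i!$ ($i\ge j$), Frobenius $\varphi$ (arithmetic Frobenius on $W(k)$, $u\mapsto u^p$), $c=\varphi(E(u))/p$. $\Sigma=W(k)[[Y]][u]/(E(u)^p-pY)\subset S$ via $Y\mapsto E(u)^p/p$; $\varphi$-stable, $\mathrm{Fil}^i\Sigma=\Sigma\cap\mathrm{Fil}^iS$, $c\in\Sigma^\times$, $\varphi_r=p^{-r}\varphi$ on $\mathrm{Fil}^r\Sigma$. $\mathrm{Mod}_\Sigma^\varphi$: triples $(M,\mathrm{Fil}^rM,\varphi_r)$ with $M$ finite free over $\Sigma$, $\mathrm{Fil}^r\Sigma\cdot M\subseteq\mathrm{Fil}^rM\subseteq M$, $\varphi_r:\mathrm{Fil}^rM\to M$ $\varphi$-semilinear with $\varphi_r(sx)=c^{-r}\varphi_r(s)\varphi_r(E(u)^rx)$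 ($s\in\mathrm{Fil}^r\Sigma$, $x\in M$), $\varphi_r(\mathrm{Fil}^rM)$ generating $M$, $M/\mathrm{Fil}^rM$ $p$-torsion free. *)

(* Defs.v *)
From HB Require Import structures.
From mathcomp Require Import all_boot all_order all_algebra qpoly boolp.

Set Implicit Arguments.
Unset Strict Implicit.
Unset Printing Implicit Defensive.

Import GRing.Theory.
Local Open Scope ring_scope.

Definition powser (R : Type) : Type := nat -> R.

Section PowerSeries.
Variable R : comNzRingType.
Implicit Types f g h : powser R.

HB.instance Definition _ := gen_eqMixin (powser R).
HB.instance Definition _ := gen_choiceMixin (powser R).

Definition psC (a : R) : powser R := fun n => if n == 0%N then a else 0.
Definition psY : powser R := fun n => (n == 1%N)%:R.
Definition ps_add f g : powser R := fun n => f n + g n.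
Definition ps_opp f : powser R := fun n => - f n.
Definition ps_mul f g : powser R := fun n => \sum_(i < n.+1) f i * g (n - i)%N.

Fact ps_addA : associative ps_add.
Proof. by move=> f g h; apply: funext => n; apply: addrA. Qed.
Fact ps_addC : commutative ps_add.
Proof. by move=> f g; apply: funext => n; apply: addrC. Qed.
Fact ps_add0 : left_id (psC 0) ps_add.
Proof.
by move=> f; apply: funext => n; rewrite /ps_add /psC if_same add0r.
Qed.
Fact ps_addN : left_inverse (psC 0) ps_opp ps_add.
Proof.
by move=> f; apply: funext => n; rewrite /ps_add /ps_opp /psC if_same addNr.
Qed.

HB.instance Definition _ :=
  GRing.isZmodule.Build (powser R) ps_addA ps_addC ps_add0 ps_addN.

Lemma ps_mul_trunc f g (p q : {poly R}) n :
    (forall i, (i <= n)%N -> p`_i = f i) ->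
    (forall i, (i <= n)%N -> q`_i = g i) ->
  ps_mul f g n = (p * q)`_n.
Proof.
move=> pf qg; rewrite coefM; apply: eq_bigr => i _.
by rewrite pf ?qg ?leq_subr // -ltnS.
Qed.

Let tr n f : {poly R} := \poly_(i < n.+1) f i.

Let trE n f i : (i <= n)%N -> (tr n f)`_i = f i.
Proof. by move=> le_in; rewrite coef_poly ltnS le_in. Qed.

Fact ps_mulA : associative ps_mul.
Proof.
move=> f g h; apply: funext => n.
rewrite (@ps_mul_trunc f _ (tr n f) (tr n g * tr n h)); first last.
- move=> i le_in; rewrite -(@ps_mul_trunc g h) // => j le_ji;
    exact: trE (leq_trans le_ji le_in).
- by move=> i; apply: trE.
rewrite (@ps_mul_trunc _ h (tr n f * tr n g) (tr n h)) ?mulrA //.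
  move=> i le_in; rewrite -(@ps_mul_trunc f g) // => j le_ji;
    exact: trE (leq_trans le_ji le_in).
by move=> i; apply: trE.
Qed.

Fact ps_mulC : commutative ps_mul.
Proof.
move=> f g; apply: funext => n.
rewrite (@ps_mul_trunc f g (tr n f) (tr n g)); try by move=> i; apply: trE.
by rewrite mulrC -(@ps_mul_trunc g f) // => i; apply: trE.
Qed.

Lemma ps_mulCl a f : ps_mul (psC a) f = (fun n => a * f n).
Proof.
apply: funext => n; rewrite /ps_mul big_ord_recl subn0 big1 ?addr0 // => i _.
by rewrite mul0r.
Qed.

Fact ps_mul1 : left_id (psC 1) ps_mul.
Proof. by move=> f; rewrite ps_mulCl; apply: funext => n; rewrite mul1r. Qed.

Fact ps_mulD : left_distributive ps_mul ps_add.
Proof.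
move=> f g h; apply: funext => n; rewrite /ps_mul /ps_add -big_split /=.
by apply: eq_bigr => i _; rewrite mulrDl.
Qed.

Fact ps_one_neq0 : psC 1 != psC 0.
Proof. by apply/eqP => /(congr1 (@^~ 0%N))/eqP; rewrite /psC /= oner_eq0. Qed.

HB.instance Definition _ := GRing.Zmodule_isComNzRing.Build (powser R)
  ps_mulA ps_mulC ps_mul1 ps_mulD ps_one_neq0.

Fact psC_is_zmod_morphism : zmod_morphism psC.
Proof.
move=> a b; apply: funext => n; rewrite /psC.
change ((if n == 0%N then a - b else 0) =
  (if n == 0%N then a else 0) - (if n == 0%N then b else 0)).
by case: (n == 0%N); rewrite ?subr0.
Qed.

Fact psC_is_monoid_morphism : monoid_morphism psC.
Proof.
split=> // a b; apply/esym/(etrans (ps_mulCl a (psC b))); apply: funext => n.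
by rewrite /psC; case: (n == 0%N); rewrite ?mulr0.
Qed.

HB.instance Definition _ :=
  GRing.isZmodMorphism.Build R (powser R) psC psC_is_zmod_morphism.
HB.instance Definition _ :=
  GRing.isMonoidMorphism.Build R (powser R) psC psC_is_monoid_morphism.

End PowerSeries.

Arguments psY {R}.

Section Padic.
Variable p : nat.

Definition ppow_dvd (A : comPzRingType) (n : nat) (x : A) : Prop :=
  exists y : A, x = (p ^ n)%:R * y.

Definition p_torsion_free (A : comPzRingType) : Prop :=
  forall x : A, p%:R * x = 0 -> x = 0.

Definition p_separated (A : comPzRingType) : Prop :=
  forall x : A, (forall n, ppow_dvd n x) -> x = 0.

Definition p_complete (A : comPzRingType) : Prop :=
  forall x : nat -> A, (forall n, ppow_dvd n (x n.+1 - x n)) ->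
  exists l : A, forall n, ppow_dvd n (l - x n).

Definition perfect_field_of_char (k : fieldType) : Prop :=
  p \in [pchar k] /\ forall x : k, exists y : k, y ^+ p = x.

(* [W] with the reduction map [red] is the ring of Witt vectors of the perfect
   field [k], i.e. the strict p-ring with residue field [k]; this determines
   [W] up to a unique isomorphism over [k]. *)
Record is_Witt_ring (k : fieldType) (W : comNzRingType)
    (red : {rmorphism W -> k}) : Prop := {
  witt_torsion_free : p_torsion_free W;
  witt_separated : p_separated W;
  witt_complete : p_complete W;
  witt_red_surj : forall a : k, exists w : W, red w = a;
  witt_red_ker : forall w : W, red w = 0 <-> ppow_dvd 1 w
}.

(* The arithmetic Frobenius of W(k) is the unique ring endomorphism lifting
   the p-th power map of [k]. *)
Definition is_Witt_Frobenius (k : fieldType) (W : comNzRingType)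
    (red : {rmorphism W -> k}) (sigma : {rmorphism W -> W}) : Prop :=
  forall w : W, red (sigma w) = red w ^+ p.

Definition is_Eisenstein (W : comNzRingType) (e : nat) (E : {poly W}) : Prop :=
  [/\ (0 < e)%N, size E = e.+1, E \is monic,
      forall i, (i < e)%N -> ppow_dvd 1 E`_i & ~ ppow_dvd 2 E`_0].

(* [kappa] exhibits [S] as lim_n D/p^n D, the kernel of S -> D/p^n D being
   p^n S. *)
Record is_p_completion (D S : comNzRingType) (kappa : {rmorphism D -> S}) :
    Prop := {
  compl_separated : p_separated S;
  compl_complete : p_complete S;
  compl_dense : forall n (s : S), exists d : D, ppow_dvd n (s - kappa d);
  compl_inj : forall n (d : D), ppow_dvd n (kappa d) -> ppow_dvd n d
}.

End Padic.

Definition is_ideal (A : comPzRingType) (I : A -> Prop) : Prop :=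
  [/\ I 0, forall x y, I x -> I y -> I (x + y) & forall a x, I x -> I (a * x)].

(* [gamma n x] is only meaningful for [x] in [I]. *)
Record is_pd_structure (A : comPzRingType) (I : A -> Prop)
    (gamma : nat -> A -> A) : Prop := {
  pd_ideal : is_ideal I;
  pd_0 : forall x, I x -> gamma 0%N x = 1;
  pd_1 : forall x, I x -> gamma 1%N x = x;
  pd_in : forall n x, (0 < n)%N -> I x -> I (gamma n x);
  pd_add : forall n x y, I x -> I y ->
    gamma n (x + y) = \sum_(i < n.+1) gamma i x * gamma (n - i)%N y;
  pd_scale : forall n a x, I x -> gamma n (a * x) = a ^+ n * gamma n x;
  pd_mul : forall m n x, I x ->
    gamma m x * gamma n x = 'C(m + n, m)%:R * gamma (m + n)%N x;
  pd_comp : forall m n x, (0 < n)%N -> I x ->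
    gamma m (gamma n x) =
    ((m * n)`! %/ (m`! * n`! ^ m))%N%:R * gamma (m * n)%N x
}.

Definition is_pd_morphism (A B : comPzRingType) (I : A -> Prop)
    (gamma : nat -> A -> A) (J : B -> Prop) (delta : nat -> B -> B)
    (f : A -> B) : Prop :=
  forall x, I x -> J (f x) /\ forall n, f (gamma n x) = delta n (f x).

(* (D, J, gamma), with iota : A -> D, is the divided power envelope of A with
   respect to the principal ideal (a). *)
Record is_pd_envelope (A : comPzRingType) (a : A) (D : comPzRingType)
    (iota : {rmorphism A -> D}) (J : D -> Prop) (gamma : nat -> D -> D) :
    Prop := {
  env_pd : is_pd_structure J gamma;
  env_in : J (iota a);
  env_ex : forall (B : comPzRingType) (K : B -> Prop) (delta : nat -> B -> B)
      (f : {rmorphism A -> B}), is_pd_structure K delta -> K (f a) ->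
    exists2 g : {rmorphism D -> B},
      is_pd_morphism J gamma K delta g & forall x, g (iota x) = f x;
  env_uniq : forall (B : comPzRingType) (K : B -> Prop)
      (delta : nat -> B -> B) (g1 g2 : {rmorphism D -> B}),
    is_pd_structure K delta ->
    is_pd_morphism J gamma K delta g1 -> is_pd_morphism J gamma K delta g2 ->
    (forall x, g1 (iota x) = g2 (iota x)) -> forall d, g1 d = g2 d
}.

(* The ideal of D generated by the divided powers gamma_i(x), i >= j. *)
Definition pd_filtration (D : comPzRingType) (gamma : nat -> D -> D) (x : D)
    (j : nat) (d : D) : Prop :=
  exists n (a : nat -> D), d = \sum_(i < n) a i * gamma (j + i)%N x.

(* Image in S of the p-adic completion of an ideal I of D: the sums of the
   series sum_n p^n y_n with y_n in I. *)
Definition completed_ideal (p : nat) (D S : comPzRingType)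
    (kappa : {rmorphism D -> S}) (I : D -> Prop) (s : S) : Prop :=
  exists2 y : nat -> D, forall n, I (y n) &
    forall N, ppow_dvd p N (s - \sum_(n < N) (p ^ n)%:R * kappa (y n)).

(* The Frobenius of W(k)[u]: sigma on coefficients, u |-> u^p. *)
Definition poly_frob (W : comNzRingType) (p : nat) (sigma : {rmorphism W -> W})
    (q : {poly W}) : {poly W} := map_poly sigma q \Po 'X^p.

(* E(u)^p - pY in W[[Y]][u]; it is monic of positive degree in u when E is
   monic of positive degree and p > 0, so that the quotient below is the
   expected one. *)
Definition Sigma_poly (W : comNzRingType) (p : nat) (E : {poly W}) :
    {poly powser W} :=
  map_poly (@psC W) E ^+ p - (p%:R * psY)%:P.

Definition Sigma (W : comNzRingType) (p : nat) (E : {poly W}) : Type :=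
  {poly %/ Sigma_poly p E}.

HB.instance Definition _ (W : comNzRingType) (p : nat) (E : {poly W}) :=
  GRing.ComNzRing.on (Sigma p E).

Definition Sigma_of_poly (W : comNzRingType) (p : nat) (E q : {poly W}) :
    Sigma p E := in_qpoly (Sigma_poly p E) (map_poly (@psC W) q).

Definition Sigma_Y (W : comNzRingType) (p : nat) (E : {poly W}) : Sigma p E :=
  in_qpoly (Sigma_poly p E) psY%:P.

(* [j] is the inclusion of Sigma in S over W(k)[u]; the image
   (p-1)! gamma_p(E) of Y is the element E(u)^p / p. *)
Record is_Sigma_inclusion (W : comNzRingType) (p : nat) (E : {poly W})
    (D S : comNzRingType) (iota : {rmorphism {poly W} -> D})
    (gamma : nat -> D -> D) (kappa : {rmorphism D -> S})
    (j : {rmorphism Sigma p E -> S}) : Prop := {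
  incl_inj : injective j;
  incl_poly : forall q : {poly W}, j (Sigma_of_poly p E q) = kappa (iota q);
  incl_Y : j (Sigma_Y p E) = (p.-1)`!%:R * kappa (gamma p (iota E))
}.

Definition Fil_S (W : comNzRingType) (p : nat) (E : {poly W})
    (D S : comNzRingType) (iota : {rmorphism {poly W} -> D})
    (gamma : nat -> D -> D) (kappa : {rmorphism D -> S}) (i : nat) :
    S -> Prop :=
  completed_ideal p kappa (pd_filtration gamma (iota E) i).

Definition Fil_Sigma (W : comNzRingType) (p : nat) (E : {poly W})
    (D S : comNzRingType) (iota : {rmorphism {poly W} -> D})
    (gamma : nat -> D -> D) (kappa : {rmorphism D -> S})
    (j : {rmorphism Sigma p E -> S}) (i : nat) (x : Sigma p E) : Prop :=
  Fil_S p E iota gamma kappa i (j x).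

Section Modules.
Variables (A : comNzRingType) (M : lmodType A).
Implicit Types N X : M -> Prop.

Definition is_submodule N : Prop :=
  [/\ N 0, forall x y, N x -> N y -> N (x + y) &
      forall (a : A) x, N x -> N (a *: x)].

Definition submodule_span X (x : M) : Prop :=
  exists n (a : 'I_n -> A) (v : 'I_n -> M),
    (forall i, X (v i)) /\ x = \sum_(i < n) a i *: v i.

(* The subset [N] of [M] is a submodule which is finite free over [A]. *)
Definition finite_free N : Prop :=
  exists n (b : 'I_n -> M),
    (forall x, N x <-> exists a : 'I_n -> A, x = \sum_(i < n) a i *: b i) /\
    (forall a : 'I_n -> A,
       \sum_(i < n) a i *: b i = 0 -> forall i, a i = 0).

(* The objects of Mod^phi_Sigma, with A = Sigma, FilA = Fil^r Sigma,
   phirA = phi_r on Sigma, Eu = E(u), cV = c^{-1}.  [phirM] is only meaningful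
   on [FilM]. *)
Record is_filtered_phi_module (p r : nat) (FilA : A -> Prop)
    (phi phirA : A -> A) (Eu cV : A) (FilM : M -> Prop) (phirM : M -> M) :
    Prop := {
  fpm_free : finite_free (fun _ => True);
  fpm_Fil : is_submodule FilM;
  fpm_FilA : forall s x, FilA s -> FilM (s *: x);
  fpm_phir_add : forall x y, FilM x -> FilM y ->
    phirM (x + y) = phirM x + phirM y;
  fpm_phir_scale : forall (a : A) x, FilM x ->
    phirM (a *: x) = phi a *: phirM x;
  fpm_phir_Fil : forall s x, FilA s ->
    phirM (s *: x) = (cV ^+ r * phirA s) *: phirM (Eu ^+ r *: x);
  fpm_gen : forall x,
    submodule_span (fun y => exists2 z, FilM z & y = phirM z) x;
  fpm_torsion_free : forall x : M, FilM (p%:R *: x) -> FilM x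
}.

Definition phi_of_phir (r : nat) (Eu cV : A) (phirM : M -> M) (x : M) : M :=
  cV ^+ r *: phirM (Eu ^+ r *: x).

Definition phi_star (phiM : M -> M) (n : nat) : M -> Prop :=
  submodule_span (fun y => exists x, y = iter n phiM x).

Definition mult_part (phiM : M -> M) (x : M) : Prop :=
  forall n, (1 <= n)%N -> phi_star phiM n x.

End Modules.

(* Main.v *)
(* Sigma is a local ring with maximal ideal m = (p, Y, u), complete and separated
   for the m-adic topology, and phi preserves m; nothing else about Sigma matters.
   In a basis of M, phi is given by a matrix B, and the span of phi^n(M) is the
   column space of B_n = B phi(B) ... phi^(n-1)(B).  Replacing phi by a power,
   the rank of B_n modulo m is constant for n >= 1, so that modulo m the image of
   phi is a stable subspace on which phi is invertible.  A contraction argument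
   lifts it to a free stable direct summand M1 of M on which phi still has an
   invertible matrix, whence M1 lies in the span of every phi^n(M), while phi is
   zero modulo m on M/M1.  Hence the span of phi^n(M/M1) lies in m^n (M/M1), and
   the intersection is M1. *)
Require Import Defs.
From HB Require Import structures.
From mathcomp Require Import all_boot all_order all_algebra qpoly boolp.
From mathcomp Require Import ring.

Set Implicit Arguments.
Unset Strict Implicit.
Unset Printing Implicit Defensive.

Import GRing.Theory.
Local Open Scope ring_scope.

(* [I n] plays the role of the n-th power of the maximal ideal [ker rho]. *)
Record complete_local (A : comNzRingType) (K : fieldType)
    (rho : {rmorphism A -> K}) (I : nat -> A -> Prop) : Prop := {
  cl_ideal : forall n, is_ideal (I n);
  cl_zero : forall x, I 0%N x;
  cl_ker : forall x, I 1%N x <-> rho x = 0;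
  cl_surj : forall a, exists x, rho x = a;
  cl_mul : forall n x y, I 1%N x -> I n y -> I n.+1 (x * y);
  cl_separated : forall x, (forall n, I n x) -> x = 0;
  cl_complete : forall x : nat -> A, (forall n, I n (x n.+1 - x n)) ->
    exists l, forall n, I n (l - x n)
}.

(** * Units, matrices and fixed points over a complete local ring *)

Section CompleteLocal.
Variables (A : comNzRingType) (K : fieldType) (rho : {rmorphism A -> K}).
Variable I : nat -> A -> Prop.
Hypothesis hI : complete_local rho I.

Lemma cl0 n : I n 0.
Proof. by case: (cl_ideal hI n). Qed.

Lemma clD n x y : I n x -> I n y -> I n (x + y).
Proof. by case: (cl_ideal hI n) => _ + _; apply. Qed.

Lemma clMl n a x : I n x -> I n (a * x).
Proof. by case: (cl_ideal hI n) => _ _; apply. Qed.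

Lemma clMr n a x : I n x -> I n (x * a).
Proof. by rewrite mulrC; apply: clMl. Qed.

Lemma clN n x : I n x -> I n (- x).
Proof. by rewrite -mulN1r; apply: clMl. Qed.

Lemma clB n x y : I n x -> I n y -> I n (x - y).
Proof. by move=> hx hy; apply/clD/clN. Qed.

Lemma cl_sum n (J : Type) (s : seq J) (F : J -> A) :
  (forall i, I n (F i)) -> I n (\sum_(i <- s) F i).
Proof.
move=> hF; elim/big_ind: _ => // *; [exact: cl0 | exact: clD].
Qed.

Lemma cl_exp n x : I 1%N x -> I n (x ^+ n).
Proof.
move=> hx; elim: n => [|n IH]; first exact: cl_zero hI _.
by rewrite exprS; apply: (cl_mul hI).
Qed.

(** The geometric series of [z] converges by completeness, and separatedness turns the approximate
    inverse into an exact one. *)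
Lemma cl_geometric z : I 1%N z -> exists y, (1 - z) * y = 1.
Proof.
move=> hz; have [n|l hl] := @cl_complete _ _ _ _ hI (fun n => \sum_(i < n) z ^+ i).
  by rewrite big_ord_recr /= [X in X - _]addrC addrK; apply: cl_exp.
exists l; apply/eqP; rewrite -subr_eq0; apply/eqP/(cl_separated hI) => n.
have -> : (1 - z) * l - 1 = (1 - z) * (l - \sum_(i < n) z ^+ i) - z ^+ n.
  by rewrite mulrBr -[(1 - z) * \sum_(i < n) _]opprK -mulNr opprB -subrX1; ring.
apply: clB; [exact: clMl | exact: cl_exp].
Qed.

Lemma cl_unit x : rho x != 0 -> exists y, x * y = 1.
Proof.
move=> nz; have [y ry] := cl_surj hI (rho x)^-1.
have [|z hz] := @cl_geometric (1 - x * y).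
  by apply/(cl_ker hI); rewrite rmorphB rmorph1 rmorphM ry mulfV ?subrr.
by exists (y * z); rewrite mulrA -hz subKr.
Qed.

(** The determinant has nonzero residue, hence is a unit, and the adjugate then gives the
    inverse. *)
Lemma cl_inv_mx n (X : 'M[A]_n) : map_mx rho X \in unitmx ->
  exists2 Y, X *m Y = 1%:M & Y *m X = 1%:M.
Proof.
rewrite unitmxE unitfE det_map_mx => /cl_unit[y xy].
have e : X *m (y *: \adj X) = 1%:M.
  by rewrite -scalemxAr mul_mx_adj scale_scalar_mx mulrC xy.
by exists (y *: \adj X) => //; apply: mulmx1C.
Qed.

Lemma cl_lift_mx m n (X : 'M[K]_(m, n)) : exists Y, map_mx rho Y = X.
Proof.
have /choice[f fE] := cl_surj hI.
by exists (map_mx f X); apply/matrixP => i j; rewrite !mxE fE.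
Qed.

Definition mx_in n r s (X : 'M[A]_(r, s)) : Prop := forall i j, I n (X i j).

Lemma mx_in0 r s (X : 'M_(r, s)) : mx_in 0 X.
Proof. by move=> i j; apply: cl_zero hI _. Qed.

Lemma mx_in1 r s (X : 'M_(r, s)) : mx_in 1 X <-> map_mx rho X = 0.
Proof.
split=> [h | /matrixP h i j]; last by apply/(cl_ker hI); have := h i j; rewrite !mxE.
by apply/matrixP => i j; rewrite !mxE; apply/(cl_ker hI).
Qed.

Lemma mx_inD n r s (X Y : 'M_(r, s)) :
  mx_in n X -> mx_in n Y -> mx_in n (X + Y).
Proof. by move=> hX hY i j; rewrite mxE; apply: clD. Qed.

Lemma mx_inB n r s (X Y : 'M_(r, s)) :
  mx_in n X -> mx_in n Y -> mx_in n (X - Y).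
Proof. by move=> hX hY i j; rewrite !mxE; apply: clB. Qed.

Lemma mx_in_mull n r s t (X : 'M_(r, s)) (Y : 'M_(s, t)) :
  mx_in n X -> mx_in n (X *m Y).
Proof. by move=> hX i j; rewrite mxE; apply: cl_sum => l; apply: clMr. Qed.

Lemma mx_in_mulr n r s t (X : 'M_(r, s)) (Y : 'M_(s, t)) :
  mx_in n Y -> mx_in n (X *m Y).
Proof. by move=> hX i j; rewrite mxE; apply: cl_sum => l; apply: clMl. Qed.

Lemma mx_in_mul1l n r s t (X : 'M_(r, s)) (Y : 'M_(s, t)) :
  mx_in 1 X -> mx_in n Y -> mx_in n.+1 (X *m Y).
Proof.
move=> hX hY i j; rewrite mxE; apply: cl_sum => l.
by apply: (cl_mul hI); [apply: hX | apply: hY].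
Qed.

Lemma mx_in_mul1r n r s t (X : 'M_(r, s)) (Y : 'M_(s, t)) :
  mx_in n X -> mx_in 1 Y -> mx_in n.+1 (X *m Y).
Proof.
move=> hX hY i j; rewrite mxE; apply: cl_sum => l.
by rewrite mulrC; apply: (cl_mul hI); [apply: hY | apply: hX].
Qed.

Lemma mx_in_separated r s (X : 'M_(r, s)) : (forall n, mx_in n X) -> X = 0.
Proof.
move=> h; apply/matrixP => i j; rewrite mxE; apply: (cl_separated hI) => n.
exact: h.
Qed.

Lemma mx_in_complete r s (X : nat -> 'M_(r, s)) :
  (forall n, mx_in n (X n.+1 - X n)) -> exists l, forall n, mx_in n (l - X n).
Proof.
move=> hX.
have /choice[f hf] (ij : 'I_r * 'I_s) :
    exists l, forall n, I n (l - X n ij.1 ij.2).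
  by apply: (cl_complete hI) => n; have := hX n ij.1 ij.2; rewrite !mxE.
by exists (\matrix_(i, j) f (i, j)) => n i j; rewrite !mxE; apply: (hf (i, j)).
Qed.

(** The iterates of [T] from 0 form a Cauchy sequence. Contraction is only assumed on matrices over
    the maximal ideal, so the limit has to be shown to stay there. *)
Lemma mx_contraction_fixpoint r s (T : 'M[A]_(r, s) -> 'M[A]_(r, s)) :
    (forall X, mx_in 1 X -> mx_in 1 (T X)) ->
    (forall n X Y, mx_in 1 X -> mx_in 1 Y -> mx_in n (X - Y) ->
       mx_in n.+1 (T X - T Y)) ->
  exists2 X, mx_in 1 X & T X = X.
Proof.
move=> T1 Tc; pose X n := iter n T 0.
have X1 n : mx_in 1 (X n).
  by elim: n => [i j|n]; [rewrite mxE; apply: cl0 | apply: T1].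
have [n|L hL] := @mx_in_complete _ _ X.
  by elim: n => [|n IH]; [apply: mx_in0 | apply: Tc IH; apply: X1].
have L1 : mx_in 1 L by rewrite -(subrK (X 1%N) L); apply: mx_inD (hL _) (X1 _).
exists L => //; apply/eqP; rewrite -subr_eq0; apply/eqP/mx_in_separated.
case=> [|n]; first exact: mx_in0.
have -> : T L - L = (T L - X n.+1) - (L - X n.+1) by rewrite opprB subrKA.
by apply: mx_inB (hL _); apply: Tc (hL _); last exact: X1.
Qed.

End CompleteLocal.

(** * Iterates of Frobenius and the matrices of iterated semilinear maps *)

Lemma rmorphism_iter (A : comNzRingType) (phi : {rmorphism A -> A}) m :
  exists psi : {rmorphism A -> A}, psi =1 iter m phi.
Proof.
elim: m => [|m [f fE]]; first by exists idfun.
by exists (phi \o f) => x /=; rewrite fE.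
Qed.

Section FrobeniusProducts.
Variables (A : comNzRingType) (d : nat).
Implicit Types phi psi : {rmorphism A -> A}.

Fixpoint frob_prod (phi : {rmorphism A -> A}) (B : 'M[A]_d) n : 'M[A]_d :=
  if n is n'.+1 then B *m map_mx phi (frob_prod phi B n') else 1%:M.

(** This cocycle relation says that the semilinear map iterated m + n times is a composite. The
    iterate of [phi] enters as a bundled morphism [psi] so that [map_mx] commutes with products. *)
Lemma frob_prodD phi psi B m n : psi =1 iter m phi ->
  frob_prod phi B (m + n) = frob_prod phi B m *m map_mx psi (frob_prod phi B n).
Proof.
elim: m psi => [|m IH] psi psiE.
  by rewrite mul1mx; apply/matrixP => i j; rewrite !mxE psiE.
have [psi' psi'E] := rmorphism_iter phi m.
rewrite addSn /= (IH _ psi'E) map_mxM mulmxA; congr (_ *m _).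
by apply/matrixP => i j; rewrite !mxE psiE /= psi'E.
Qed.

(** The products for a power of the semilinear map form a subsequence of the original ones; this
    permits replacing [phi] by a power. *)
Lemma frob_prodM phi psi B m n : psi =1 iter m phi ->
  frob_prod psi (frob_prod phi B m) n = frob_prod phi B (m * n).
Proof.
move=> psiE; elim: n => [|n IH]; first by rewrite muln0.
by rewrite mulnS (frob_prodD _ _ psiE) -IH.
Qed.
End FrobeniusProducts.

(** * The stable summand on which the semilinear map is invertible *)

Section UnitRoot.
Variables (A : comNzRingType) (K : fieldType) (rho : {rmorphism A -> K}).
Variable I : nat -> A -> Prop.
Hypothesis hI : complete_local rho I.
Variables (psi : {rmorphism A -> A}) (tau : {rmorphism K -> K}).
Hypothesis psiI : forall n x, I n x -> I n (psi x).
Hypothesis psi_tau : forall x, rho (psi x) = tau (rho x).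

Let mx_in_psi n r s (X : 'M_(r, s)) : mx_in I n X -> mx_in I n (map_mx psi X).
Proof. by move=> h i j; rewrite mxE; apply: psiI. Qed.

(* Graph transform: the columns of [col_mx 1%:M X] span a stable submodule. *)
Lemma stable_graph r s (U : 'M[A]_r) (B : 'M_(r, s)) (C : 'M_(s, r)) (N : 'M_s) :
    map_mx rho U \in unitmx -> mx_in I 1 C -> mx_in I 1 N ->
  exists2 X, mx_in I 1 X & C + N *m map_mx psi X = X *m (U + B *m map_mx psi X).
Proof.
move=> /(cl_inv_mx hI)[V UV VU] hC hN.
(* Stability of the graph reads X U = C + N psi(X) - X B psi(X); multiplying by the inverse [V] of
   [U] makes it a fixed-point equation. *)
pose T X := (C + N *m map_mx psi X - X *m B *m map_mx psi X) *m V.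
have [X hX|n X Y hX hY hXY|X hX TX] := @mx_contraction_fixpoint _ _ _ _ hI s r T.
- apply: (mx_in_mull hI); apply: (mx_inB hI); last first.
    by do 2![apply: (mx_in_mull hI)].
  by apply: (mx_inD hI) => //; apply: (mx_in_mull hI).
- rewrite /T -mulmxBl; apply: (mx_in_mull hI) => //.
  (* In each of the three terms the difference meets a factor over the maximal ideal: [N],
     [map_mx psi X] and [Y] respectively. *)
  have -> : C + N *m map_mx psi X - X *m B *m map_mx psi X -
      (C + N *m map_mx psi Y - Y *m B *m map_mx psi Y) =
      N *m map_mx psi (X - Y) - (X - Y) *m (B *m map_mx psi X) -
      Y *m B *m map_mx psi (X - Y).
    rewrite !map_mxB !mulmxBr !mulmxBl !mulmxA.
    set a := N *m _; set b := N *m _; set c := X *m _ *m _.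
    set g := Y *m _ *m _; set f := Y *m _ *m _.
    rewrite -[RHS]addrA -opprD subrKA !opprB [g - (C + b)]addrC addrACA.
    by rewrite [- c + g]addrC; congr (_ + _); rewrite opprD addrACA subrr add0r.
  apply: (mx_inB hI).
    apply: (mx_inB hI).
      by apply: (mx_in_mul1l hI) => //; apply: mx_in_psi.
    by apply: (mx_in_mul1r hI) => //; apply: (mx_in_mulr hI) => //; apply: mx_in_psi.
  by apply: (mx_in_mul1l hI) => //; [apply: (mx_in_mull hI)|apply: mx_in_psi].
have XU : X *m U = C + N *m map_mx psi X - X *m B *m map_mx psi X.
  by rewrite -{1}TX /T -[LHS]mulmxA VU mulmx1.
by exists X => //; rewrite mulmxDr mulmxA XU subrK.
Qed.

(** After the base change [P] the semilinear map has matrix [H], whose residue has zero lower rows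
    and an invertible upper left block. The columns of [F] span the stable graph, which [L] splits
    off; the remaining coordinates of an image gain one power of the ideal at each iteration. *)
Lemma cap_frob_prod_of_block r s (P P' B : 'M[A]_(r + s)) :
    P *m P' = 1%:M -> let H := P' *m B *m map_mx psi P in
    map_mx rho (ulsubmx H) \in unitmx -> mx_in I 1 (dsubmx H) ->
  exists (F : 'M[A]_(r + s, r)) (L : 'M[A]_(r, r + s)), L *m F = 1%:M /\
    forall v : 'cV_(r + s),
      (forall n, exists w, v = frob_prod psi B n *m w) <->
      exists a, v = F *m a.
Proof.
move=> PP' H Uu; rewrite -[H]submxK; rewrite col_mxKd => hd.
set U := ulsubmx H in Uu hd *; set Bu := ursubmx H.
set C := dlsubmx H in hd *; set N := drsubmx H in hd *.
have hC : mx_in I 1 C by move=> i j; have := hd i (lshift _ j); rewrite row_mxEl.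
have hN : mx_in I 1 N by move=> i j; have := hd i (rshift _ j); rewrite row_mxEr.
have P'P : P' *m P = 1%:M by apply: mulmx1C.
have [X hX eX] := stable_graph Bu Uu hC hN.
set V := U + _ in eX.
have BP : B *m map_mx psi P = P *m block_mx U Bu C N.
  by rewrite submxK /H -!mulmxA mulmxA PP' mul1mx.
have [V' VV' V'V] : exists2 V', V *m V' = 1%:M & V' *m V = 1%:M.
  apply: (cl_inv_mx hI); rewrite map_mxD map_mxM.
  suff -> : map_mx rho (map_mx psi X) = 0 by rewrite mulmx0 addr0.
  by apply/(mx_in1 hI); apply: mx_in_psi.
pose F := P *m col_mx 1%:M X; pose L := row_mx 1%:M 0 *m P'.
have BF : B *m map_mx psi F = F *m V.
  rewrite map_mxM mulmxA BP -!mulmxA map_col_mx map_mx1; congr (_ *m _).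
  by rewrite mul_block_col mul_col_mx !mulmx1 mul1mx eX.
(* [D] kills [F] and gives coordinates modulo its span. There the semilinear map has matrix
   [N - X *m Bu], which is zero modulo the maximal ideal. *)
pose D := row_mx (- X) 1%:M *m P'.
have DB : D *m B = (N - X *m Bu) *m map_mx psi D.
  have psiP : map_mx psi P *m map_mx psi P' = 1%:M by rewrite -map_mxM PP' map_mx1.
  rewrite -[LHS]mulmx1 -psiP mulmxA map_mxM [RHS]mulmxA; congr (_ *m _).
  rewrite -mulmxA BP /D -[_ *m P' *m _]mulmxA [P' *m _]mulmxA P'P mul1mx.
  rewrite mul_row_block !mul1mx !mulNmx map_row_mx map_mxN map_mx1 mul_mx_row mulmx1.
  congr (row_mx _ _); last by rewrite addrC.
  rewrite mulmxN mulmxBl opprB -mulmxA; apply/eqP.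
  by rewrite addrC subr_eq addrAC eq_sym subr_eq -mulmxDr eX [_ + U]addrC.
exists F, L; split.
  rewrite /L /F -mulmxA [P' *m _]mulmxA P'P mul1mx mul_row_col.
  by rewrite mul1mx mul0mx addr0.
move=> v; split=> [hv|[a ->] n]; last first.
  suff [Z ->] : exists Z, F = frob_prod psi B n *m Z.
    by exists (Z *m a); rewrite mulmxA.
  elim: n => [|n [Z hZ]]; first by exists F; rewrite mul1mx.
  (* As [V] is invertible, [F] is recovered from its own image [B *m map_mx psi F = F *m V]. *)
  exists (map_mx psi Z *m V') => /=.
  by rewrite mulmxA -[B *m _ *m _]mulmxA -map_mxM -hZ BF -mulmxA VV' mulmx1.
have Dn n : mx_in I n (D *m frob_prod psi B n).
  elim: n => [|n IH]; first exact: mx_in0 hI _ _ _.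
  rewrite /= mulmxA DB -mulmxA -map_mxM.
  apply: (mx_in_mul1l hI); last exact: mx_in_psi.
  by apply: (mx_inB hI) => //; apply: (mx_in_mull hI).
have Dv : D *m v = 0.
  apply: (mx_in_separated hI) => n; have [w ->] := hv n.
  by rewrite mulmxA; apply: (mx_in_mull hI).
(* [D *m v = 0] says that the lower coordinates of [P' *m v] are [X] times the upper ones, so the
   upper ones are the coefficients along [F]. *)
exists (usubmx (P' *m v)); rewrite /F -mulmxA -[LHS]mul1mx -PP' -mulmxA.
congr (_ *m _).
rewrite -{1}[P' *m v]vsubmxK mul_col_mx mul1mx; congr (col_mx _ _).
move: Dv; rewrite /D -mulmxA -{1}[P' *m v]vsubmxK mul_row_col mul1mx mulNmx.
by move/eqP; rewrite addrC subr_eq0 => /eqP.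
Qed.

(* If the rank of [B0 *m tau B0] has not dropped, the image of [B0] is stable
   and the semilinear map is bijective on it; lift the basis [col_ebase B0]. *)
Lemma cap_frob_prod_of_rank r s (B : 'M[A]_(r + s)) :
    let B0 := map_mx rho B in
    \rank B0 = r -> \rank (B0 *m map_mx tau B0) = r ->
  exists (F : 'M[A]_(r + s, r)) (L : 'M[A]_(r, r + s)), L *m F = 1%:M /\
    forall v : 'cV_(r + s),
      (forall n, exists w, v = frob_prod psi B n *m w) <->
      exists a, v = F *m a.
Proof.
move=> B0 rB rBB; pose P0 := col_ebase B0; pose Q0 := row_ebase B0.
have P0u : P0 \in unitmx by apply: col_ebase_unit.
have B0E : B0 = P0 *m (col_mx 1%:M 0 *m row_mx 1%:M 0) *m Q0.
  rewrite -[LHS]mulmx_ebase rB; congr (_ *m _ *m _).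
  by rewrite mul_col_row !mulmx0 !mul0mx mulmx1 -pid_mx_block.
have [P PE] := cl_lift_mx hI P0.
have [|P' PP' _] := @cl_inv_mx _ _ _ _ hI _ P; first by rewrite PE.
have P'E : map_mx rho P' = invmx P0.
  by rewrite -[LHS](mulKmx P0u) -{2}PE -map_mxM PP' map_mx1 mulmx1.
(* In the basis [P0] the residual matrix is [Z] with its lower rows replaced by zero. *)
pose Z := Q0 *m map_mx tau P0.
have HE : map_mx rho (P' *m B *m map_mx psi P) =
    col_mx 1%:M 0 *m row_mx 1%:M 0 *m Z.
  have -> : map_mx rho (P' *m B *m map_mx psi P) =
      invmx P0 *m B0 *m map_mx tau P0.
    rewrite !map_mxM P'E -PE; congr (_ *m _).
    by apply/matrixP => i j; rewrite !mxE psi_tau.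
  by rewrite B0E -!mulmxA mulKmx.
apply: (cap_frob_prod_of_block PP').
  have -> : map_mx rho (ulsubmx (P' *m B *m map_mx psi P)) = ulsubmx Z.
    rewrite map_ulsubmx HE -mulmxA mul_col_mx mul1mx mul0mx /ulsubmx col_mxKu.
    by rewrite -[Z in LHS]vsubmxK mul_row_col mul1mx mul0mx addr0.
  (* The residual product factors through the upper left block of [Z], so its rank r forces this
     block to be invertible. *)
  rewrite -row_full_unit /row_full eqn_leq rank_leq_row -{1}rBB.
  have -> : B0 *m map_mx tau B0 =
      P0 *m col_mx 1%:M 0 *m ulsubmx Z *m (row_mx 1%:M 0 *m map_mx tau Q0).
    have -> : ulsubmx Z = row_mx 1%:M 0 *m Z *m col_mx 1%:M 0.
      rewrite -{2}[Z]submxK mul_row_block !mul1mx !mul0mx !addr0 mul_row_col.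
      by rewrite mulmx1 mulmx0 addr0.
    by rewrite {2}B0E !map_mxM map_col_mx map_row_mx !map_mx1 !map_mx0 B0E !mulmxA.
  by apply: leq_trans (mxrankM_maxl _ _) (mxrankM_maxr _ _).
apply/(mx_in1 hI); rewrite map_dsubmx HE -mulmxA mul_col_mx mul0mx.
by rewrite col_mxKd.
Qed.
End UnitRoot.

(** * From matrices to a semilinear endomorphism of a free module *)

Section SemilinearEndomorphism.
Variables (A : comNzRingType) (K : fieldType) (rho : {rmorphism A -> K}).
Variable I : nat -> A -> Prop.
Hypothesis hI : complete_local rho I.
Variables (phi : {rmorphism A -> A}) (tau : {rmorphism K -> K}).
Hypothesis phiI : forall n x, I n x -> I n (phi x).
Hypothesis phi_tau : forall x, rho (phi x) = tau (rho x).

(* The ranks of the residual products are nonincreasing, so replacing [phi] by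
   a power reduces to the case where they are constant. *)
Lemma cap_frob_prod d (B : 'M[A]_d) :
  exists r (F : 'M[A]_(d, r)) (L : 'M[A]_(r, d)), L *m F = 1%:M /\
    forall v : 'cV_d,
      (forall n, exists w, v = frob_prod phi B n *m w) <->
      exists a, v = F *m a.
Proof.
pose f n := \rank (map_mx rho (frob_prod phi B n)).
have f_dec m n : (f (m + n) <= f m)%N.
  have [psi psiE] := rmorphism_iter phi m.
  by rewrite /f (frob_prodD _ _ psiE) map_mxM; apply: mxrankM_maxl.
have [N fN] : exists N, forall n, (f N <= f n)%N.
  have exf : exists m, `[< exists n, f n = m >].
    by exists (f 0%N); apply/asboolP; exists 0%N.
  have [_ /asboolP[N <-] fN] := ex_minnP exf.
  by exists N => n; apply: fN; apply/asboolP; exists n.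
(* The successor makes [h] positive, so that n <= h * n and the products of index h * n are cofinal
   among all of them. *)
pose h := N.+1.
have fh n : f (h + n)%N = f N.
  by apply/eqP; rewrite eqn_leq fN andbT /h addSnnS f_dec.
have [psi psiE] := rmorphism_iter phi h.
have [tauh tauhE] := rmorphism_iter tau h.
have psi_tauh x : rho (psi x) = tauh (rho x).
  by rewrite psiE tauhE; elim: (h) => //= n IH; rewrite phi_tau IH.
have psiI n x : I n x -> I n (psi x).
  by move=> Ix; rewrite psiE; elim: (h) => //= m IH; apply: phiI.
pose Bh := frob_prod phi B h.
have rB : \rank (map_mx rho Bh) = f N by rewrite -(fh 0%N) addn0.
have rBB : \rank (map_mx rho Bh *m map_mx tauh (map_mx rho Bh)) = f N.
  rewrite -(fh h) /f (frob_prodD _ _ psiE) map_mxM; congr (\rank (_ *m _)).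
  by apply/matrixP => i j; rewrite !mxE psi_tauh.
suff [r [F [L [LF FE]]]] : exists r (F : 'M[A]_(d, r)) (L : 'M[A]_(r, d)),
    L *m F = 1%:M /\
    forall v : 'cV_d,
      (forall n, exists w, v = frob_prod psi Bh n *m w) <-> exists a, v = F *m a.
  exists r, F, L; split=> // v; rewrite -FE; split=> hv n.
    by rewrite (frob_prodM _ _ psiE); apply: hv.
  have [w] := hv n; rewrite (frob_prodM _ _ psiE) mulSn.
  have [psin psinE] := rmorphism_iter phi n.
  by rewrite (frob_prodD _ _ psinE) -mulmxA => ->; eexists.
(* Splitting the dimension as rank plus corank gives the matrices the block shape required above. *)
have [s ds] : exists s, d = (f N + s)%N.
  by exists (d - f N)%N; rewrite subnKC // -rB rank_leq_row.
move: Bh rB rBB; move: (f N) ds => r ds {f f_dec fN fh}; subst d => Bh rB rBB.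
by exists r; apply: (cap_frob_prod_of_rank hI psiI psi_tauh rB rBB).
Qed.

(** In coordinates the span of the n-th image is the column space of the n-th Frobenius product, so
    the matrix result applies. *)
Lemma mult_part_finite_free (M : lmodType A) (f : M -> M) :
    {morph f : x y / x + y} -> (forall a x, f (a *: x) = phi a *: f x) ->
  finite_free (fun _ : M => True) -> finite_free (mult_part f).
Proof.
move=> fD fZ [d [b [b_gen b_free]]].
pose emb (v : 'cV[A]_d) := \sum_i v i 0 *: b i.
have embD : {morph emb : v w / v + w}.
  move=> v w; rewrite /emb -big_split /=; apply: eq_bigr => i _.
  by rewrite mxE scalerDl.
have embZ a v : emb (a *: v) = a *: emb v.
  by rewrite scaler_sumr; apply: eq_bigr => i _; rewrite mxE scalerA.
have emb0 : emb 0 = 0 by rewrite -(scale0r 0) embZ scale0r.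
have emb_sum n (F : 'I_n -> 'cV_d) : emb (\sum_i F i) = \sum_i emb (F i).
  exact: (big_morph emb embD emb0).
have emb_inj v w : emb v = emb w -> v = w.
  move=> e; apply/matrixP => i j; rewrite ord1.
  apply/eqP; rewrite -subr_eq0; apply/eqP.
  have -> : v i 0 - w i 0 = (v - w) i 0 by rewrite !mxE.
  apply: (b_free (fun i => (v - w) i 0)).
  by rewrite -/(emb (v - w)) embD -scaleN1r embZ scaleN1r e subrr.
have emb_surj x : exists v, x = emb v.
  have [a ->] := (b_gen x).1 Logic.I; exists (\col_i a i).
  by apply: eq_bigr => i _; rewrite mxE.
have f0 : f 0 = 0 by rewrite -(scale0r 0) fZ rmorph0 !scale0r.
have f_sum n (F : 'I_n -> M) : f (\sum_i F i) = \sum_i f (F i).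
  exact: (big_morph f fD f0).
have /choice[Bc BcE] j := emb_surj (f (b j)).
pose B : 'M[A]_d := \matrix_(i, j) Bc j i 0.
have mulE (C : 'M[A]_d) v : C *m v = \sum_j v j 0 *: col j C.
  apply/matrixP => i j; rewrite ord1 mxE summxE; apply: eq_bigr => l _.
  by rewrite !mxE mulrC.
have f_emb v : f (emb v) = emb (B *m map_mx phi v).
  rewrite f_sum mulE emb_sum; apply: eq_bigr => j _; rewrite fZ BcE embZ mxE.
  by congr (_ *: emb _); apply/matrixP => i l; rewrite ord1 !mxE.
have iter_emb n v :
    iter n f (emb v) = emb (frob_prod phi B n *m map_mx (iter n phi) v).
  elim: n => [|n IH] /=.
    by rewrite mul1mx; congr emb; apply/matrixP => i j; rewrite mxE.
  rewrite IH f_emb map_mxM mulmxA; congr (emb (_ *m _)).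
  by apply/matrixP => i j; rewrite !mxE.
have starE n v : phi_star f n (emb v) <-> exists w, v = frob_prod phi B n *m w.
  split=> [[m [a [x [hx e]]]] | [w ->]].
    have /choice[y yE] i : exists y, x i = emb (frob_prod phi B n *m y).
      have [z ->] := hx i; have [u ->] := emb_surj z.
      by rewrite iter_emb; eexists.
    exists (\sum_i a i *: y i); apply: emb_inj; rewrite e mulmx_sumr emb_sum.
    by apply: eq_bigr => i _; rewrite yE -scalemxAr embZ.
  exists d, (fun j => w j 0), (fun j => iter n f (b j)); split; first by eexists.
  rewrite mulE emb_sum; apply: eq_bigr => j _; rewrite embZ; congr (_ *: _).
  have bE : b j = emb (delta_mx j 0).
    rewrite /emb (bigD1 j) //= big1 => [|i ne].
      by rewrite !mxE !eqxx scale1r addr0.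
    by rewrite !mxE (negPf ne) scale0r.
  (* Ring morphisms fix the entries 0 and 1 of a unit vector, so the n-th iterate sends [b j] to the
     j-th column of the product. *)
  have [psi psiE] := rmorphism_iter phi n.
  rewrite bE iter_emb; congr emb; rewrite colE; congr (_ *m _).
  by apply/matrixP => i l; rewrite !mxE -psiE rmorph_nat.
have [r [F [L [LF FE]]]] := cap_frob_prod B.
have FaE a : \sum_(i < r) a i *: emb (col i F) = emb (F *m \col_i a i).
  have -> : F *m \col_i a i = \sum_i a i *: col i F.
    apply/matrixP => i j; rewrite ord1 mxE summxE; apply: eq_bigr => l _.
    by rewrite !mxE mulrC.
  by rewrite emb_sum; apply: eq_bigr => i _; rewrite embZ.
exists r, (fun i => emb (col i F)); split=> [x | a].
  have [v ->] := emb_surj x.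
  have -> : mult_part f (emb v) <-> exists a, v = F *m a.
    (* The index n = 0, absent from [mult_part], imposes no condition since the empty product is the
       identity. *)
    rewrite -FE; split=> [hv [|n] | hv n _]; last exact/starE.
      by exists v; rewrite mul1mx.
    exact/starE/hv.
  split=> [[a ->] | [a]].
    exists (fun i => a i 0); rewrite FaE; congr (emb (_ *m _)).
    by apply/matrixP => i j; rewrite ord1 mxE.
  by rewrite FaE => /emb_inj ->; eexists.
(* The left inverse [L] of [F] yields linear independence. *)
rewrite FaE -emb0 => /emb_inj /(congr1 (mulmx L)).
by rewrite mulmxA LF mul1mx mulmx0 => /matrixP e i; have := e i 0; rewrite !mxE.
Qed.

End SemilinearEndomorphism.

(** * Powers of an ideal with three generators *)

Section IdealPowers.
Variable A : comNzRingType.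
Implicit Types a b c x y : A.

(** This is the ideal (a, b, c)^n; taking c = 0 gives the powers of (a, b), so one definition serves
    both (p, Y, u) and (p, Y). *)
Fixpoint gen_pow a b c n x : Prop :=
  if n is m.+1 then
    exists x1 x2 x3, [/\ gen_pow a b c m x1, gen_pow a b c m x2,
      gen_pow a b c m x3 & x = a * x1 + b * x2 + c * x3]
  else True.

Lemma gen_pow_ideal a b c n : is_ideal (gen_pow a b c n).
Proof.
elim: n => [|n [h0 hD hM]] //=; split.
- by exists 0, 0, 0; split=> //; ring.
- move=> _ _ [x1 [x2 [x3 [? ? ? ->]]]] [y1 [y2 [y3 [? ? ? ->]]]].
  by exists (x1 + y1), (x2 + y2), (x3 + y3); split; [apply: hD..|ring].
- move=> t _ [x1 [x2 [x3 [? ? ? ->]]]].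
  by exists (t * x1), (t * x2), (t * x3); split; [apply: hM..|ring].
Qed.

Lemma gen_powD a b c n x y :
  gen_pow a b c n x -> gen_pow a b c n y -> gen_pow a b c n (x + y).
Proof. by case: (gen_pow_ideal a b c n) => _ + _; apply. Qed.

Lemma gen_powMl a b c n t x : gen_pow a b c n x -> gen_pow a b c n (t * x).
Proof. by case: (gen_pow_ideal a b c n) => _ _; apply. Qed.

Lemma gen_powM a b c m n x y :
  gen_pow a b c m x -> gen_pow a b c n y -> gen_pow a b c (m + n) (x * y).
Proof.
elim: m x => [|m IH] x; first by move=> _; apply: gen_powMl.
move=> [x1 [x2 [x3 [h1 h2 h3 ->]]]] hy.
exists (x1 * y), (x2 * y), (x3 * y).
by split; [exact: IH..|ring].
Qed.

Lemma gen_powX a b c m n x : gen_pow a b c m x -> gen_pow a b c (m * n) (x ^+ n).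
Proof.
move=> hx; elim: n => [|n IH]; first by rewrite muln0.
by rewrite exprS mulnS; apply: gen_powM.
Qed.

Lemma gen_powS a b c n x : gen_pow a b c n.+1 x -> gen_pow a b c n x.
Proof.
by move=> [? [? [? [? ? ? ->]]]]; do ![apply: gen_powD | apply: gen_powMl].
Qed.

Lemma gen_powW a b c m n x : (m <= n)%N -> gen_pow a b c n x -> gen_pow a b c m x.
Proof.
move=> /subnKC <-; elim: (n - m)%N => [|l IH]; first by rewrite addn0.
by rewrite addnS => /gen_powS.
Qed.

Lemma gen_pow_rmorph a b c (f : {rmorphism A -> A}) n x :
    gen_pow a b c 1 (f a) -> gen_pow a b c 1 (f b) -> gen_pow a b c 1 (f c) ->
  gen_pow a b c n x -> gen_pow a b c n (f x).
Proof.
move=> fa fb fc; elim: n x => [|n IH] //= _ [x1 [x2 [x3 [h1 h2 h3 ->]]]].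
rewrite !rmorphD !rmorphM.
by do 2?[apply: (@gen_powD a b c n.+1)]; apply: (@gen_powM a b c 1); auto.
Qed.

Lemma gen_pow_sub2 a b c n x : gen_pow a b 0 n x -> gen_pow a b c n x.
Proof.
elim: n x => [|n IH] //= x [x1 [x2 [x3 [h1 h2 h3 ->]]]].
exists x1, x2, 0; split; [exact: IH..| |ring].
by case: (gen_pow_ideal a b c n).
Qed.

(* An element of (a, b, c)^n times c^i is a combination of monomials
   a^l b^m c^q with l + m + q >= n + i, and c^K lies in (a, b). *)
Lemma gen_pow_root a b c K n i x : (0 < K)%N -> gen_pow a b 0 1 (c ^+ K) ->
  gen_pow a b c n x -> gen_pow a b 0 ((n + i) %/ K) (x * c ^+ i).
Proof.
move=> K0 cK; elim: n i x => [|n IH] i x.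
  move=> _; apply: gen_powMl; rewrite add0n.
  have -> : c ^+ i = c ^+ (i %% K) * (c ^+ K) ^+ (i %/ K).
    by rewrite -exprM -exprD mulnC addnC -divn_eq.
  by apply: gen_powMl; have := gen_powX (i %/ K) cK; rewrite mul1n.
move=> [x1 [x2 [x3 [h1 h2 h3 ->]]]].
(* The terms in [a] and [b] gain a power of (a, b), while the factor [c] of the last term is
   absorbed into the exponent [i]. *)
have -> : (a * x1 + b * x2 + c * x3) * c ^+ i =
    a * (x1 * c ^+ i) + b * (x2 * c ^+ i) + 0 * 0 + x3 * c ^+ i.+1.
  by rewrite exprS; ring.
apply: gen_powD; last by rewrite addSnnS; apply: IH.
apply: (@gen_powW _ _ _ _ ((n + i) %/ K).+1).
  have -> : (((n + i) %/ K).+1 = (n + i + K) %/ K)%N.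
    by rewrite (divnDr _ (dvdnn K)) divnn K0 addn1.
  by apply: leq_div2r; rewrite addSn -addn1 leq_add2l.
exists (x1 * c ^+ i), (x2 * c ^+ i), 0; split; [exact: IH..| |by []].
by case: (gen_pow_ideal a b 0 ((n + i) %/ K)).
Qed.

End IdealPowers.

(** * Sigma as a complete local ring with residue field k *)

Section SigmaRing.
Variables (p e : nat) (k : fieldType) (W : comNzRingType).
Variables (red : {rmorphism W -> k}) (E : {poly W}).
Hypotheses (hp : prime p) (hW : is_Witt_ring p red) (hE : is_Eisenstein p e E).

Local Notation Sig := (Sigma p E).

Lemma powser_0E i : (0 : powser W) i = 0.
Proof. by rewrite /0%R /= /psC if_same. Qed.

Lemma powser_natE n (f : powser W) i : (n%:R * f) i = n%:R * f i.
Proof.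
rewrite !mulr_natl; elim: n => [|n IH]; last by rewrite !mulrS -IH.
by rewrite !mulr0n powser_0E.
Qed.

Lemma powser_addE (f g : powser W) i : (f + g) i = f i + g i.
Proof. by []. Qed.

Lemma powser_oppE (f : powser W) i : (- f) i = - f i.
Proof. by []. Qed.

Lemma powser_mul0E (f g : powser W) : (f * g) 0%N = f 0%N * g 0%N.
Proof. by rewrite [LHS]big_ord_recl big_ord0 addr0. Qed.

Lemma powser_YE (f : powser W) i : (psY * f) i = if i is j.+1 then f j else 0.
Proof.
case: i => [|i]; first by rewrite powser_mul0E mul0r.
rewrite [LHS]big_ord_recl mul0r add0r big_ord_recl mul1r big1 ?addr0 ?subn1 //.
by move=> j _; rewrite mul0r.
Qed.

Let monE : E \is monic.
Proof. by case: hE. Qed.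

Let p_gt0 : (0 < p)%N.
Proof. exact: prime_gt0. Qed.

Lemma size_Sigma_poly_lead : (1 < size (map_poly (@psC W) E ^+ p))%N.
Proof.
have monE' : map_poly (@psC W) E \is monic by apply: monic_map.
have sE : (1 < size (map_poly (@psC W) E))%N.
  rewrite size_map_poly_id0; first by case: hE => e0 -> *.
  by rewrite (monicP monE) rmorph1 oner_neq0.
rewrite -(prednK p_gt0) exprS size_monicM // ?monic_neq0 ?monic_exp //.
have : (0 < size (map_poly (@psC W) E ^+ p.-1)%R)%N.
  by rewrite size_poly_gt0 monic_neq0 ?monic_exp.
by case: (size _) => // m _; rewrite addnS /= (leq_trans sE) ?leq_addr.
Qed.

Lemma size_Sigma_poly : (1 < size (Sigma_poly p E))%N.
Proof.
rewrite size_polyDl ?size_Sigma_poly_lead // size_polyN.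
exact: leq_ltn_trans (size_polyC_leq1 _) size_Sigma_poly_lead.
Qed.

Lemma monic_Sigma_poly : Sigma_poly p E \is monic.
Proof.
rewrite monicE lead_coefDl; first by rewrite -monicE monic_exp ?monic_map.
rewrite size_polyN; exact: leq_ltn_trans (size_polyC_leq1 _) size_Sigma_poly_lead.
Qed.

(** [qpoly] divides by [mk_monic], which substitutes a default for unsuitable polynomials; no
    substitution happens here. *)
Lemma mk_monic_Sigma_poly : mk_monic (Sigma_poly p E) = Sigma_poly p E.
Proof. by rewrite /mk_monic size_Sigma_poly monic_Sigma_poly. Qed.

Definition Sigma_proj : {rmorphism {poly powser W} -> Sig} :=
  in_qpoly (Sigma_poly p E).

(** The coefficient of u^i Y^j in the reduced representative. *)
Definition Sigma_coef (x : Sig) (i j : nat) : W := (polyn x)`_i j.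

Local Notation deg := (size (mk_monic (Sigma_poly p E))).-1.

Definition Sigma_of_coef (g : nat -> nat -> W) : Sig :=
  Sigma_proj (\poly_(i < deg) (g i : powser W)).

Lemma Sigma_proj_small (q : {poly powser W}) : (size q <= deg)%N ->
  polyn (Sigma_proj q) = q.
Proof.
by move=> hq; apply: in_qpoly_small; rewrite -(prednK (size_mk_monic_gt0 _)) ltnS.
Qed.

Lemma Sigma_of_coefK g i j : (i < deg)%N -> Sigma_coef (Sigma_of_coef g) i j = g i j.
Proof.
by move=> hi; rewrite /Sigma_coef Sigma_proj_small ?size_poly // coef_poly hi.
Qed.

Lemma Sigma_coef_big (x : Sig) i j : (deg <= i)%N -> Sigma_coef x i j = 0.
Proof. by move=> hi; rewrite /Sigma_coef big_coef_npoly // powser_0E. Qed.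

Lemma Sigma_coef_inj (x y : Sig) :
  (forall i j, (i < deg)%N -> Sigma_coef x i j = Sigma_coef y i j) -> x = y.
Proof.
move=> h; apply: val_inj; apply/polyP => i; apply: funext => j.
by case: (ltnP i deg) => hi; [apply: h | rewrite !big_coef_npoly].
Qed.

Lemma Sigma_coefD (x y : Sig) i j :
  Sigma_coef (x + y) i j = Sigma_coef x i j + Sigma_coef y i j.
Proof. by rewrite /Sigma_coef [polyn _](poly_of_qpolyD x y) coefD. Qed.

Lemma Sigma_coefN (x : Sig) i j : Sigma_coef (- x) i j = - Sigma_coef x i j.
Proof. by rewrite /Sigma_coef /= coefN. Qed.

Lemma Sigma_coef0 i j : Sigma_coef 0 i j = 0.
Proof. by rewrite /Sigma_coef /= coef0 powser_0E. Qed.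

Lemma Sigma_projK (x : Sig) : Sigma_proj (polyn x) = x.
Proof. by apply: val_inj; rewrite [LHS]Sigma_proj_small // size_npoly. Qed.

Lemma Sigma_coef_scale (f : powser W) (x : Sig) i j :
  Sigma_coef (Sigma_proj f%:P * x) i j = (f * (polyn x)`_i) j.
Proof.
rewrite -{1}[x]Sigma_projK -rmorphM mul_polyC /Sigma_coef Sigma_proj_small ?coefZ //.
exact: leq_trans (size_scale_leq _ _) (size_npoly _).
Qed.

Lemma Sigma_coef_nat n (x : Sig) i j :
  Sigma_coef (n%:R * x) i j = n%:R * Sigma_coef x i j.
Proof.
by rewrite -(rmorph_nat Sigma_proj) -polyC_natr Sigma_coef_scale powser_natE.
Qed.

Lemma Sigma_coef_Y (x : Sig) i j :
  Sigma_coef (Sigma_Y p E * x) i j = if j is j'.+1 then Sigma_coef x i j' else 0.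
Proof. by rewrite [LHS]Sigma_coef_scale powser_YE. Qed.

Lemma Sigma_torsion_free (x y : Sig) : p%:R * x = p%:R * y -> x = y.
Proof.
move=> e0; apply: Sigma_coef_inj => i j _; apply/eqP; rewrite -subr_eq0; apply/eqP.
apply: (witt_torsion_free hW); rewrite mulrBr -!Sigma_coef_nat e0; exact: subrr.
Qed.

(** A factor p adds a power of p to every coefficient, and a factor Y shifts j by one. With its
    converse below, this reduces the (p, Y)-adic topology to the p-adic topology of W on
    coefficients. *)
Lemma dvd_coef_of_gen_pow n (x : Sig) : gen_pow p%:R (Sigma_Y p E) 0 n x ->
  forall i j, ppow_dvd p (n - j) (Sigma_coef x i j).
Proof.
elim: n x => [|n IH] x /=.
  by move=> _ i j; exists (Sigma_coef x i j); rewrite mul1r.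
move=> [x1 [x2 [x3 [h1 h2 _ ->]]]] i j.
rewrite mul0r addr0 Sigma_coefD Sigma_coef_nat Sigma_coef_Y.
have [y ->] := IH _ h1 i j; case: j => [|j].
  by exists y; rewrite !subn0 addr0 expnS natrM mulrA.
have [z ->] := IH _ h2 i j; rewrite subSS subnS mulrA -natrM -expnS.
case: (n - j)%N => [|m] /=; first by exists (p%:R * y + z); rewrite !mul1r expn1.
by exists (y + z); rewrite mulrDr.
Qed.

Lemma gen_pow_of_dvd_coef n (x : Sig) :
    (forall i j, ppow_dvd p (n - j) (Sigma_coef x i j)) ->
  gen_pow p%:R (Sigma_Y p E) 0 n x.
Proof.
elim: n x => [|n IH] x h //=.
have /choice[g hg] i := h i 0%N.
(* The part free of Y supplies the multiple of p, and all the rest is a multiple of Y. *)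
exists (Sigma_of_coef (fun i j => if j is 0 then (p ^ n)%:R * g i else 0)).
exists (Sigma_of_coef (fun i j => Sigma_coef x i j.+1)), 0; split.
- apply: IH => i j; case: (ltnP i deg) => hi.
    rewrite Sigma_of_coefK //; case: j => [|j]; first by exists (g i); rewrite subn0.
    by exists 0; rewrite mulr0.
  by exists 0; rewrite Sigma_coef_big ?mulr0.
- apply: IH => i j; case: (ltnP i deg) => hi.
    by rewrite Sigma_of_coefK //; have := h i j.+1; rewrite subSS.
  by exists 0; rewrite Sigma_coef_big ?mulr0.
- by case: (gen_pow_ideal (p%:R : Sig) (Sigma_Y p E) 0 n).
apply: Sigma_coef_inj => i j hi.
rewrite mul0r addr0 Sigma_coefD Sigma_coef_nat Sigma_coef_Y.
case: j => [|j]; rewrite !Sigma_of_coefK // ?mulr0 ?add0r ?addr0 //.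
by rewrite hg subn0 expnS natrM mulrA.
Qed.

Lemma Sigma_pY_separated (x : Sig) :
  (forall n, gen_pow p%:R (Sigma_Y p E) 0 n x) -> x = 0.
Proof.
move=> h; apply: Sigma_coef_inj => i j _; rewrite Sigma_coef0.
apply: (witt_separated hW) => n.
by have := dvd_coef_of_gen_pow (h (n + j)%N) i j; rewrite addnK.
Qed.

Lemma Sigma_pY_complete (x : nat -> Sig) :
    (forall n, gen_pow p%:R (Sigma_Y p E) 0 n (x n.+1 - x n)) ->
  exists l, forall n, gen_pow p%:R (Sigma_Y p E) 0 n (l - x n).
Proof.
move=> h.
(* Step m controls the coefficient of Y^j only modulo p^(m - j), so the sequence is shifted by j
   before passing to the limit in W. *)
have /choice[g hg] (ij : nat * nat) : exists l,
    forall n, ppow_dvd p n (l - Sigma_coef (x (n + ij.2)%N) ij.1 ij.2).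
  apply: (witt_complete hW) => n.
  have := dvd_coef_of_gen_pow (h (n + ij.2)%N) ij.1 ij.2.
  by rewrite addnK Sigma_coefD Sigma_coefN addSn.
exists (Sigma_of_coef (fun i j => g (i, j))) => n; apply: gen_pow_of_dvd_coef => i j.
case: (ltnP i deg) => hi; last by exists 0; rewrite Sigma_coef_big ?mulr0.
rewrite Sigma_coefD Sigma_coefN Sigma_of_coefK //.
case: (leqP j n) => hj; first by have := hg (i, j) (n - j)%N; rewrite /= subnK.
by rewrite (eqP (ltnW hj : (_ == _))); eexists; rewrite mul1r.
Qed.

Local Notation u := (Sigma_of_poly p E 'X).
Local Notation Y := (Sigma_Y p E).
Local Notation m_pow := (gen_pow (p%:R : Sig) Y u).

Lemma Sigma_of_poly_E : Sigma_of_poly p E E ^+ p = p%:R * Y.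
Proof.
have Q0 : Sigma_proj (Sigma_poly p E) = 0.
  apply: val_inj; rewrite /= mk_monic_Sigma_poly.
  exact: Pdiv.RingMonic.rmodpp monic_Sigma_poly.
apply/eqP; rewrite -subr_eq0 -[p%:R](rmorph_nat Sigma_proj); apply/eqP.
rewrite -[RHS]Q0 /Sigma_poly rmorphB rmorphXn; congr (_ - _).
by rewrite -rmorphM -polyC_natr -polyCM.
Qed.

(** Since E = u^e + pG, the difference u^(ep) - E^p is a multiple of p; and E^p = pY in Sigma. *)
Lemma Sigma_u_root : gen_pow p%:R Y 0 1 (u ^+ (e * p)).
Proof.
have [e0 sE _ dE _] := hE.
have /choice[g hg] i : exists g, (i < e)%N -> E`_i = p%:R * g.
  case: (ltnP i e) => // hi; last by exists 0.
  by have [y ->] := dE i hi; exists y; rewrite expn1.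
have EE : E = 'X^e + p%:R * \poly_(i < e) g i.
  apply/polyP => i; rewrite coefD coefXn mulr_natl coefMn coef_poly.
  case: (ltngtP i e) => hi; rewrite ?add0r ?mul0rn ?addr0.
  - by rewrite hg // mulr_natl.
  - by rewrite nth_default // sE.
  - by have /monicP := monE; rewrite lead_coefE sE hi.
set G := \poly_(i < e) g i in EE.
have EG : Sigma_of_poly p E E = u ^+ e + p%:R * Sigma_of_poly p E G.
  have mE : map_poly (@psC W) E = 'X^e + p%:R * map_poly (@psC W) G.
    by rewrite {1}EE rmorphD rmorphM rmorph_nat /= map_polyXn.
  rewrite [LHS](congr1 Sigma_proj mE) rmorphD rmorphM rmorph_nat rmorphXn.
  by rewrite /Sigma_of_poly map_polyX.
have := subrXX (u ^+ e) (Sigma_of_poly p E E) p.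
set s := \sum_(i < p) _; rewrite Sigma_of_poly_E -exprM {1}EG => hs.
exists (Y - Sigma_of_poly p E G * s), 0, 0; split=> //.
move/eqP: hs; rewrite subr_eq => /eqP ->; ring.
Qed.

Let ep_gt0 : (0 < e * p)%N.
Proof. by rewrite muln_gt0 p_gt0; case: hE => ->. Qed.

(** Makes the (p, Y, u)-adic and (p, Y)-adic topologies agree, so separatedness and completeness
    carry over. *)
Lemma m_pow_pY n x : m_pow (e * p * n) x -> gen_pow p%:R Y 0 n x.
Proof.
move/(gen_pow_root 0 ep_gt0 Sigma_u_root).
by rewrite expr0 mulr1 addn0 mulKn.
Qed.

Lemma m_pow_complete (x : nat -> Sig) :
    (forall n, m_pow n (x n.+1 - x n)) ->
  exists l, forall n, m_pow n (l - x n).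
Proof.
move=> h; have far n i : m_pow n (x (n + i)%N - x n).
  elim: i => [|i IH].
    by rewrite addn0 subrr; case: (gen_pow_ideal (p%:R : Sig) Y u n).
  rewrite addnS -(subrKA (x (n + i)%N)); apply: gen_powD => //.
  by apply: gen_powW (h _); rewrite leq_addr.
have [n|l hl] := @Sigma_pY_complete (fun n => x (e * p * n)%N).
  by apply: m_pow_pY; rewrite mulnS addnC; apply: far.
exists l => n; rewrite -(subrKA (x (e * p * n)%N)); apply: gen_powD.
  exact: gen_pow_sub2.
have -> : (e * p * n = n + (e * p * n - n))%N by rewrite subnKC // leq_pmull.
exact: far.
Qed.

Definition Sigma_res (x : Sig) : k := red (Sigma_coef x 0 0).

(** Any representative may be used, because the constant term of [Sigma_poly] at Y = 0 is E(0)^p,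
    which [red] kills. *)
Lemma Sigma_res_proj q : Sigma_res (Sigma_proj q) = red (q`_0 0%N).
Proof.
rewrite {2}(Pdiv.RingMonic.rdivp_eq monic_Sigma_poly q) coefD coef0M powser_addE.
rewrite powser_mul0E rmorphD rmorphM.
suff -> : red ((Sigma_poly p E)`_0 0%N) = 0.
  by rewrite mulr0 add0r /Sigma_res /Sigma_coef /= mk_monic_Sigma_poly.
rewrite /Sigma_poly coefB coefC eqxx powser_addE powser_oppE powser_natE mulr0 subr0.
rewrite -!horner_coef0 horner_exp horner_coef0 coef_map.
rewrite -rmorphXn /= /psC eqxx rmorphXn.
have [e0 _ _ dE _] := hE.
by rewrite ((witt_red_ker hW _).2 (dE _ e0)) expr0n gtn_eqF.
Qed.

Fact Sigma_res_is_zmod_morphism : zmod_morphism Sigma_res.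
Proof. by move=> x y; rewrite /Sigma_res Sigma_coefD Sigma_coefN rmorphB. Qed.

Fact Sigma_res_is_monoid_morphism : monoid_morphism Sigma_res.
Proof.
split; first by rewrite -(rmorph1 Sigma_proj) Sigma_res_proj coef1 rmorph1.
move=> x y; rewrite -[x]Sigma_projK -[y]Sigma_projK -rmorphM !Sigma_res_proj.
by rewrite coef0M powser_mul0E rmorphM.
Qed.

HB.instance Definition _ :=
  GRing.isZmodMorphism.Build Sig k Sigma_res Sigma_res_is_zmod_morphism.
HB.instance Definition _ :=
  GRing.isMonoidMorphism.Build Sig k Sigma_res Sigma_res_is_monoid_morphism.

Lemma Sigma_res_p : Sigma_res p%:R = 0.
Proof.
rewrite rmorph_nat -(rmorph_nat red); apply/(witt_red_ker hW).
by exists 1; rewrite mulr1 expn1.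
Qed.

Lemma Sigma_res_Y : Sigma_res Y = 0.
Proof. by rewrite [LHS]Sigma_res_proj coefC rmorph0. Qed.

Lemma Sigma_res_u : Sigma_res u = 0.
Proof. by rewrite [LHS]Sigma_res_proj map_polyX coefX rmorph0. Qed.

Lemma Sigma_res_ker (x : Sig) : m_pow 1 x <-> Sigma_res x = 0.
Proof.
split=> [[x1 [x2 [x3 [_ _ _ ->]]]] | /(witt_red_ker hW)[w hw]].
  by rewrite !rmorphD !rmorphM /= Sigma_res_p Sigma_res_Y Sigma_res_u !mul0r !addr0.
rewrite -[x]Sigma_projK; set q := polyn x.
(* Split the representative as p w + Y f + u q', with p w its constant coefficient. *)
pose f : powser W := fun j => q`_0 j.+1.
pose q' := \poly_(i < size q) q`_i.+1.
exists (Sigma_proj (psC w)%:P), (Sigma_proj f%:P), (Sigma_proj q'); split=> //.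
rewrite -[p%:R](rmorph_nat Sigma_proj) /Sigma_Y /Sigma_of_poly map_polyX.
rewrite -!/(Sigma_proj _) -!rmorphM -!rmorphD; congr (Sigma_proj _).
rewrite -polyC_natr -!polyCM -polyCD; apply/polyP => -[|i].
  rewrite coefD coefC coefXM addr0; apply: funext => j /=.
  rewrite powser_addE powser_natE powser_YE /psC; case: j => [|j] /=.
    by rewrite addr0 [LHS]hw expn1.
  by rewrite mulr0 add0r.
rewrite coefD coefC coefXM add0r coef_poly.
by case: ltnP => // hi; rewrite nth_default // (leq_trans hi).
Qed.

Lemma Sigma_complete_local : complete_local Sigma_res m_pow.
Proof.
split=> //.
- exact: gen_pow_ideal.
- exact: Sigma_res_ker.
- move=> a; have [w <-] := witt_red_surj hW a.
  by exists (Sigma_proj (psC w)%:P); rewrite [LHS]Sigma_res_proj coefC.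
- by move=> n x y; apply: (@gen_powM _ _ _ _ 1).
- by move=> x h; apply: Sigma_pY_separated => n; apply: m_pow_pY.
- exact: m_pow_complete.
Qed.

End SigmaRing.

(** * Divided powers, and Frobenius on Sigma and M *)

Lemma pd_expr (A : comPzRingType) (I : A -> Prop) (gamma : nat -> A -> A) n x :
  is_pd_structure I gamma -> I x -> x ^+ n = n`!%:R * gamma n x.
Proof.
move=> hg Ix; elim: n => [|n IH]; first by rewrite (pd_0 hg) // mulr1.
rewrite exprS IH mulrCA -{1}(pd_1 hg Ix) (pd_mul hg 1 n Ix) bin1 add1n mulrA -natrM.
by rewrite factS mulnC.
Qed.

Lemma completed_ideal_incl (p : nat) (D S : comPzRingType)
    (kappa : {rmorphism D -> S}) (I : D -> Prop) d :
  I 0 -> I d -> completed_ideal p kappa I (kappa d).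
Proof.
move=> I0 Id; exists (fun n => if n is 0 then d else 0) => [[]//|[|N]].
  by exists (kappa d); rewrite big_ord0 subr0 mul1r.
exists 0; rewrite big_ord_recl mul1r big1 ?addr0 ?subrr ?mulr0 // => i _.
by rewrite rmorph0 mulr0.
Qed.

Theorem theorem2p3p1
  (p r e : nat) (hp : prime p) (hr : (r <= p - 1)%N)
  (* W(k) and its Frobenius, E(u) *)
  (k : fieldType) (hk : perfect_field_of_char p k)
  (W : comNzRingType) (red : {rmorphism W -> k}) (hW : is_Witt_ring p red)
  (sigma : {rmorphism W -> W}) (hsigma : is_Witt_Frobenius p red sigma)
  (E : {poly W}) (hE : is_Eisenstein p e E)
  (* S, with its Frobenius *)
  (D : comNzRingType) (iota : {rmorphism {poly W} -> D})
  (J : D -> Prop) (gamma : nat -> D -> D)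
  (hD : is_pd_envelope E iota J gamma)
  (S : comNzRingType) (kappa : {rmorphism D -> S})
  (hS : is_p_completion p kappa)
  (phiS : {rmorphism S -> S})
  (hphiS : forall q : {poly W},
     phiS (kappa (iota q)) = kappa (iota (poly_frob p sigma q)))
  (* Sigma inside S, with the restriction of phi, c, c^-1 and phi_r *)
  (j : {rmorphism Sigma p E -> S})
  (hj : is_Sigma_inclusion iota gamma kappa j)
  (phi : {rmorphism Sigma p E -> Sigma p E})
  (hphi : forall x, j (phi x) = phiS (j x))
  (c cV : Sigma p E)
  (hc : p%:R * c = phi (Sigma_of_poly p E E)) (hcV : c * cV = 1)
  (phir : Sigma p E -> Sigma p E)
  (hphir : forall s, Fil_Sigma iota gamma kappa j r s ->
     (p ^ r)%:R * phir s = phi s)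
  (* the object M of Mod^phi_Sigma *)
  (M : lmodType (Sigma p E)) (FilM : M -> Prop) (phirM : M -> M)
  (hM : is_filtered_phi_module p r (Fil_Sigma iota gamma kappa j r) phi phir
          (Sigma_of_poly p E E) cV FilM phirM) :
  finite_free (mult_part (phi_of_phir r (Sigma_of_poly p E E) cV phirM)).
Proof.
have EFil : Fil_Sigma iota gamma kappa j r (Sigma_of_poly p E E ^+ r).
  rewrite /Fil_Sigma rmorphXn (incl_poly hj) -rmorphXn.
  apply: completed_ideal_incl; first by exists 0%N, (fun=> 0); rewrite big_ord0.
  (* E^r equals r! times the r-th divided power of E. *)
  exists 1%N, (fun=> r`!%:R); rewrite big_ord1 addn0.
  exact: pd_expr (env_pd hD) (env_in hD).
(* Hence additivity and semilinearity of [phirM] on [FilM] apply at E^r x for every x. *)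
have EM x : FilM (Sigma_of_poly p E E ^+ r *: x) by apply: (fpm_FilA hM).
have phi_poly q :
    phi (Sigma_of_poly p E q) = Sigma_of_poly p E (poly_frob p sigma q).
  by apply: (incl_inj hj); rewrite hphi !(incl_poly hj) hphiS.
have hcl := Sigma_complete_local hp hW hE.
have phi_u : phi (Sigma_of_poly p E 'X) = Sigma_of_poly p E 'X ^+ p.
  rewrite phi_poly /poly_frob map_polyX comp_polyX.
  by rewrite /Sigma_of_poly map_polyXn map_polyX -rmorphXn.
have phi_Y : exists s, phi (Sigma_Y p E) = p%:R * s.
  (* p phi(Y) = phi(E)^p = (pc)^p; cancelling one p leaves p^(p-1) c^p, still a multiple of p
     because p >= 2. *)
  exists (p%:R ^+ p.-2 * c ^+ p); apply: (Sigma_torsion_free hW).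
  rewrite -[X in X * phi _](rmorph_nat phi) -rmorphM -(Sigma_of_poly_E hp hE).
  have pE : p%:R ^+ p = p%:R * (p%:R * p%:R ^+ p.-2) :> Sigma p E.
    by rewrite -!exprS; congr (_ ^+ _); case: (p) (prime_gt1 hp) => [|[]].
  by rewrite rmorphXn -hc exprMn pE -!mulrA.
set I := gen_pow _ _ _ in hcl.
have I1p t : I 1%N (p%:R * t).
  by exists t, 0, 0; split=> //; rewrite !mulr0 !addr0.
have phiI n x : I n x -> I n (phi x).
  apply: gen_pow_rmorph.
  - by rewrite rmorph_nat; have := I1p 1; rewrite mulr1.
  - by have [s ->] := phi_Y; apply: I1p.
  - rewrite phi_u -(prednK (prime_gt0 hp)) exprS mulrC.
    by eexists 0, 0, _; split=> //; rewrite !mulr0 !add0r mulrC.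
(* Modulo the maximal ideal every element is a constant from W, on which [phi] is [sigma]; so [phi]
   induces the p-th power map on k. *)
have phi_tau x : Sigma_res red (phi x) = pFrobenius_aut hk.1 (Sigma_res red x).
  have res_C w : Sigma_res red (Sigma_of_poly p E w%:P) = red w.
    by rewrite [LHS](Sigma_res_proj hp hW hE) map_polyC coefC.
  have phi_C w : phi (Sigma_of_poly p E w%:P) = Sigma_of_poly p E (sigma w)%:P.
    by rewrite phi_poly /poly_frob map_polyC comp_polyC.
  set w := Sigma_coef x 0 0.
  have : I 1%N (x - Sigma_of_poly p E w%:P).
    by apply/(cl_ker hcl); rewrite rmorphB /= res_C subrr.
  move/phiI/(cl_ker hcl); rewrite !rmorphB /= phi_C res_C hsigma.
  by move/eqP; rewrite subr_eq0 => /eqP.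
apply: (mult_part_finite_free hcl phiI phi_tau) (fpm_free hM).
- move=> x y; rewrite /phi_of_phir scalerDr (fpm_phir_add hM) //.
  exact: scalerDr.
- move=> a x; rewrite /phi_of_phir.
  have -> : Sigma_of_poly p E E ^+ r *: (a *: x) =
      a *: (Sigma_of_poly p E E ^+ r *: x) by rewrite !scalerA mulrC.
  by rewrite (fpm_phir_scale hM a (EM x)) !scalerA mulrC.
Qed.
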